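(* Fix $f^0\in V_h^L$, $\varepsilon>0$, and subtimestep lengths $\Delta t^m>0$, $m=1,\dots,M$. The low order IMEX operators $\mathcal{L}^{1,m}_u$ and $\mathcal{L}^{1,m}$ (defined in the context) are coercive, i.e. there exists $\alpha_1>0$ such that for all $f,g\in V_h^L$ and all $m=1,\dots,M$ $$\|\mathcal{L}^{1,m}_u(f^0,Pf)-\mathcal{L}^{1,m}_u(f^0,Pg)\|\ \ge\ \alpha_1\,\|Pf-Pg\|,$$ $$\|\mathcal{L}^{1,m}(f^0,f)-\mathcal{L}^{1,m}(f^0,g)\|\ \ge\ \alpha_1\,\|f-g\|.$$
   Context: Discretization. Let $\Omega_h$ be a finite triangulation of a bounded domain in $\mathbb{R}^D$, with elements denoted by $T$, and let $V_h$ be the space of real-valued globally continuous functions that are polynomials of degree at most $d$ on each element. Let $D_h$ be the finite set of degrees of freedom and $\{\varphi_\sigma\}_{\sigma\in D_h}$ the Bernstein basis of $V_h$, which consists of nonnegative functions, so that $|\mathcal{C}_\sigma|:=\int_\Omega\varphi_\sigma(x)\,dx>0$ for every $\sigma$. Elements of $V_h^L$ and $V_h^K$ (functions with values in $\mathbb{R}^L$ and $\mathbb{R}^K$, all components in $V_h$) are written $f=\sum_\sigma f_\sigma\varphi_\sigma$ and $u=\sum_\sigma u_\sigma\varphi_\sigma$ with $f_\sigma\in\mathbb{R}^L$, $u_\sigma\in\mathbb{R}^K$. Model data. $P:\mathbb{R}^L\to\mathbb{R}^K$ ($L>K$) is a constant linear map (projection matrix), acting on functions by $(Pf)_\sigma=Pf_\sigma$.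 $M(\cdot):\mathbb{R}^K\to\mathbb{R}^L$ is the Lipschitz continuous Maxwellian, satisfying $P(M(u))=u$ for all $u$ of interest (the plain integer $M\ge 1$ denotes the number of subtimesteps). For each element $T$ and each $\sigma\in T$, $\phi^T_{ad,\sigma}:V_h^L\to\mathbb{R}^L$ is a given advection nodal residual. The number $\Delta t^m=t^{n,m}-t^{n,0}>0$ is the length of the time interval from the beginning of the timestep to the $m$-th subtimestep, $\varepsilon>0$ is the relaxation parameter, and $f^0$ is the known value at the beginning of the timestep. Operators. The operators take values in functions on $D_h$ with values in $\mathbb{R}^K$ and $\mathbb{R}^L$, respectively, identified with elements of $V_h^K$ and $V_h^L$ through their coefficients. For $u\in V_h^K$, $$\mathcal{L}^{1,m}_{\sigma,u}(f^0,u)=u_\sigma-Pf^0_\sigma+\frac{\Delta t^m}{|\mathcal{C}_\sigma|}\sum_{T\mid\sigma\in T}P\phi^T_{ad,\sigma}(f^0).$$ Let $u^m\in V_h^K$ be the solution of the explicit auxiliary equation $\mathcal{L}^{1,m}_{\sigma,u}(f^0,u^m)=0$ for all $\sigma\in D_h$, so that $u^m$ is determined by $f^0$ alone. For $f\in V_h^L$, $$\mathcal{L}^{1,m}_\sigma(f^0,f)=f_\sigma-\frac{\varepsilon}{\varepsilon+\Delta t^m}f^0_\sigma+\frac{\varepsilon\,\Delta t^m}{|\mathcal{C}_\sigma|(\varepsilon+\Delta t^m)}\sum_{T\mid\sigma\in T}\phi^T_{ad,\sigma}(f^0)-\frac{\Delta t^m}{\varepsilon+\Delta t^m}M(u^m_\sigma).$$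 Norm. For a (vector-valued) function $w=\sum_\sigma w_\sigma\varphi_\sigma$, $\|w\|^2=\sum_{\sigma\in D_h}|\mathcal{C}_\sigma|\,|w_\sigma|^2$, with $|\cdot|$ the Euclidean norm. *)

(* Defs.v *)
From HB Require Import structures.
From mathcomp Require Import all_boot all_order all_algebra.
From mathcomp Require Import all_classical all_reals all_analysis.
From mathcomp Require Import -(notations) mpoly.

Set Implicit Arguments.
Unset Strict Implicit.
Unset Printing Implicit Defensive.

Import Order.TTheory GRing.Theory Num.Theory.
Import numFieldNormedType.Exports.

Local Open Scope classical_set_scope.
Local Open Scope ring_scope.

(* [l] is a vector of barycentric coordinates of [x] in the convex hull of
   the vertices [p v] with [v \in T]. *)
Definition bary_rep (R : realType) (D n : nat) (p : 'I_n -> 'rV[R]_D)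
    (T : {set 'I_n}) (l : {ffun 'I_n -> R}) (x : 'rV[R]_D) : Prop :=
  [/\ forall v, 0 <= l v,
      \sum_v l v = 1,
      forall v, v \notin T -> l v = 0
    & x = \sum_v l v *: p v].

Definition simplex (R : realType) (D n : nat) (p : 'I_n -> 'rV[R]_D)
    (T : {set 'I_n}) : set 'rV[R]_D :=
  [set x | exists l, bary_rep p T l x].

Definition affinely_independent (R : realType) (D n : nat)
    (p : 'I_n -> 'rV[R]_D) (T : {set 'I_n}) : Prop :=
  forall c : {ffun 'I_n -> R},
    (forall v, v \notin T -> c v = 0) ->
    \sum_v c v = 0 -> \sum_v c v *: p v = 0 -> forall v, c v = 0.

(* A finite conforming simplicial triangulation of a bounded domain (nonempty
   connected open set); an element is given by the set of its D+1 vertices. *)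
Record triangulation (R : realType) (D : nat) := Triangulation {
  nvert : nat;
  vertex : 'I_nvert -> 'rV[R]_D;
  elements : {set {set 'I_nvert}};
  Omega : set 'rV[R]_D;
  Omega_nonempty : Omega !=set0;
  Omega_open : open Omega;
  Omega_connected : connected Omega;
  Omega_bounded : bounded_set Omega;
  elements_card : forall T, T \in elements -> #|T| = D.+1;
  elements_nondegenerate :
    forall T, T \in elements -> affinely_independent vertex T;
  elements_conforming : forall T T', T \in elements -> T' \in elements ->
    simplex vertex T `&` simplex vertex T' = simplex vertex (T :&: T');
  elements_cover :
    closure Omega = \bigcup_(T in [set` elements]) simplex vertex T }.

Arguments vertex {R D} _ _.
Arguments elements {R D} _.
Arguments Omega {R D} _.

(* A continuous function with polynomial restrictions of total degree at most
   [d] ([mmeasure mdeg q] is the total degree plus one).  Functions are represented by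
   total functions, of which only the values on the closure of [Omega] matter. *)
Definition Vh (R : realType) (D : nat) (Oh : triangulation R D) (d : nat) :
    set ('rV[R]_D -> R) :=
  [set f | {within closure (Omega Oh), continuous f} /\
     forall T, T \in elements Oh ->
       exists2 q : mpoly D R, (mmeasure mdeg q <= d.+1)%N
         & forall x, simplex (vertex Oh) T x ->
             f x = meval (fun j => x 0 j) q].

(* [VhV Oh d n] is V_h^n. *)
Definition VhV (R : realType) (D : nat) (Oh : triangulation R D) (d n : nat) :
    set ('rV[R]_D -> 'cV[R]_n) :=
  [set f | forall i, Vh Oh d (fun x => f x i 0)].

Definition msupport (n d : nat) (a : {ffun 'I_n -> 'I_d.+1}) : {set 'I_n} :=
  [set v | (0 < a v)%N].

(* The Bernstein degrees of freedom are the multi-indices over the vertices, of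
   total degree [d], whose support consists of vertices of a common element. *)
Definition is_dof (R : realType) (D : nat) (Oh : triangulation R D) (d : nat)
    (a : {ffun 'I_(nvert Oh) -> 'I_d.+1}) : bool :=
  (\sum_v a v == d)%N && [exists T in elements Oh, msupport a \subset T].

Record dof (R : realType) (D : nat) (Oh : triangulation R D) (d : nat) := Dof {
  dof_index :> {ffun 'I_(nvert Oh) -> 'I_d.+1};
  _ : is_dof dof_index }.

HB.instance Definition _ (R : realType) (D : nat) (Oh : triangulation R D)
  (d : nat) := [isSub for @dof_index R D Oh d].
HB.instance Definition _ (R : realType) (D : nat) (Oh : triangulation R D)
  (d : nat) := [Equality of dof Oh d by <:].
HB.instance Definition _ (R : realType) (D : nat) (Oh : triangulation R D)
  (d : nat) := [Choice of dof Oh d by <:].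
HB.instance Definition _ (R : realType) (D : nat) (Oh : triangulation R D)
  (d : nat) := [Countable of dof Oh d by <:].
HB.instance Definition _ (R : realType) (D : nat) (Oh : triangulation R D)
  (d : nat) := [Finite of dof Oh d by <:].

(* sigma \in T: the support is included in T, that is (for d > 0), the domain
   point \sum_v (sigma v / d) *: vertex v lies in the closed simplex T. *)
Definition dof_in (R : realType) (D : nat) (Oh : triangulation R D) (d : nat)
    (sigma : dof Oh d) (T : {set 'I_(nvert Oh)}) : bool :=
  msupport sigma \subset T.

(* The barycentric coordinates of a point of the closure of [Omega], extended
   by 0 to the vertices outside the element containing it; by conformity they
   do not depend on that element. *)
Definition bary (R : realType) (D : nat) (Oh : triangulation R D)
    (x : 'rV[R]_D) : {ffun 'I_(nvert Oh) -> R} :=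
  xget [ffun=> 0]
    [set l | exists2 T, T \in elements Oh & bary_rep (vertex Oh) T l x].

(* On an element T containing sigma this is the Bernstein polynomial
   d! / \prod_v (sigma v)! * \prod_v lambda_v ^ (sigma v) of T; on any other
   element some lambda_v with 0 < sigma v vanishes identically. *)
Definition bernstein (R : realType) (D : nat) (Oh : triangulation R D)
    (d : nat) (sigma : dof Oh d) (x : 'rV[R]_D) : R :=
  d`!%:R / (\prod_v (sigma v)`!)%N%:R * \prod_v bary Oh x v ^+ sigma v.

(* The D-dimensional Lebesgue integral, as an iterated integral; it is used
   only for nonnegative Borel functions (Tonelli). *)
Fixpoint iterated_integral (R : realType) (n : nat) :
    ('rV[R]_n -> \bar R) -> \bar R :=
  match n with
  | 0 => fun F => F 0
  | n'.+1 => fun F =>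
      (\int[@lebesgue_measure R]_(t in setT)
         iterated_integral (fun y : 'rV[R]_n' =>
           F (row_mx (t%:M : 'rV[R]_1) y)))%E
  end.

(* |C_sigma| *)
Definition cell (R : realType) (D : nat) (Oh : triangulation R D) (d : nat)
    (sigma : dof Oh d) : R :=
  fine (iterated_integral
          (fun x => ((bernstein sigma \_ (Omega Oh)) x)%:E)).

Definition expand (R : realType) (D : nat) (Oh : triangulation R D) (d n : nat)
    (c : {ffun dof Oh d -> 'cV[R]_n}) (x : 'rV[R]_D) : 'cV[R]_n :=
  \sum_sigma bernstein sigma x *: c sigma.

(* The coefficients f_sigma of f = \sum_sigma f_sigma phi_sigma; they exist and
   are unique for f in V_h^n, since the phi_sigma form a basis of V_h. *)
Definition coef (R : realType) (D : nat) (Oh : triangulation R D) (d n : nat)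
    (f : 'rV[R]_D -> 'cV[R]_n) : {ffun dof Oh d -> 'cV[R]_n} :=
  xget [ffun=> 0]
    [set c | forall x, closure (Omega Oh) x -> f x = expand c x].

Definition enorm (R : realType) (n : nat) (v : 'cV[R]_n) : R :=
  Num.sqrt (\sum_i v i 0 ^+ 2).

Definition normh (R : realType) (D : nat) (Oh : triangulation R D) (d n : nat)
    (w : 'rV[R]_D -> 'cV[R]_n) : R :=
  Num.sqrt (\sum_(sigma : dof Oh d)
              cell sigma * enorm (coef Oh d w sigma) ^+ 2).

Definition applyP (R : realType) (D : nat) (Oh : triangulation R D)
    (d K L : nat) (P : 'M[R]_(K, L)) (f : 'rV[R]_D -> 'cV[R]_L) :
    'rV[R]_D -> 'cV[R]_K :=
  expand [ffun sigma => P *m coef Oh d f sigma].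

Definition lipschitz_map (R : realType) (m n : nat)
    (F : 'cV[R]_m -> 'cV[R]_n) : Prop :=
  exists k : R, forall u v, enorm (F u - F v) <= k * enorm (u - v).

(* phi T sigma is the advection nodal residual phi^T_{ad,sigma}; only its
   values for elements T containing sigma are used. *)
Definition residuals (R : realType) (D : nat) (Oh : triangulation R D)
    (d L : nat) : Type :=
  {set 'I_(nvert Oh)} -> dof Oh d -> ('rV[R]_D -> 'cV[R]_L) -> 'cV[R]_L.

Definition L1u_node (R : realType) (D : nat) (Oh : triangulation R D)
    (d K L : nat) (P : 'M[R]_(K, L)) (phi : residuals Oh d L) (dt : R)
    (f0 : 'rV[R]_D -> 'cV[R]_L) (u : 'rV[R]_D -> 'cV[R]_K)
    (sigma : dof Oh d) : 'cV[R]_K :=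
  coef Oh d u sigma - P *m coef Oh d f0 sigma
  + (dt / cell sigma) *:
      \sum_(T in elements Oh | dof_in sigma T) P *m phi T sigma f0.

Definition L1_node (R : realType) (D : nat) (Oh : triangulation R D)
    (d K L : nat) (Mx : 'cV[R]_K -> 'cV[R]_L) (phi : residuals Oh d L)
    (eps dt : R) (um : 'rV[R]_D -> 'cV[R]_K)
    (f0 f : 'rV[R]_D -> 'cV[R]_L) (sigma : dof Oh d) : 'cV[R]_L :=
  coef Oh d f sigma
  - (eps / (eps + dt)) *: coef Oh d f0 sigma
  + (eps * dt / (cell sigma * (eps + dt))) *:
      \sum_(T in elements Oh | dof_in sigma T) phi T sigma f0
  - (dt / (eps + dt)) *: Mx (coef Oh d um sigma).

(* A family indexed by the degrees of freedom is identified with the function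
   of V_h^n having these coefficients. *)
Definition L1u (R : realType) (D : nat) (Oh : triangulation R D)
    (d K L : nat) (P : 'M[R]_(K, L)) (phi : residuals Oh d L) (dt : R)
    (f0 : 'rV[R]_D -> 'cV[R]_L) (u : 'rV[R]_D -> 'cV[R]_K) :
    'rV[R]_D -> 'cV[R]_K :=
  expand [ffun sigma => L1u_node P phi dt f0 u sigma].

Definition L1 (R : realType) (D : nat) (Oh : triangulation R D)
    (d K L : nat) (Mx : 'cV[R]_K -> 'cV[R]_L) (phi : residuals Oh d L)
    (eps dt : R) (um : 'rV[R]_D -> 'cV[R]_K)
    (f0 f : 'rV[R]_D -> 'cV[R]_L) : 'rV[R]_D -> 'cV[R]_L :=
  expand [ffun sigma => L1_node Mx phi eps dt um f0 f sigma].

Definition is_aux_solution (R : realType) (D : nat) (Oh : triangulation R D)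
    (d K L : nat) (P : 'M[R]_(K, L)) (phi : residuals Oh d L) (dt : R)
    (f0 : 'rV[R]_D -> 'cV[R]_L) (u : 'rV[R]_D -> 'cV[R]_K) : Prop :=
  VhV Oh d u /\ forall sigma, L1u_node P phi dt f0 u sigma = 0.

(* Main.v *)
Require Import Defs.
From mathcomp Require Import all_boot all_order all_algebra.
From mathcomp Require Import all_classical all_reals all_analysis.
From mathcomp Require Import -(notations) mpoly.

Set Implicit Arguments.
Unset Strict Implicit.
Unset Printing Implicit Defensive.

Import Order.TTheory GRing.Theory Num.Theory.
Import numFieldNormedType.Exports.

Local Open Scope classical_set_scope.
Local Open Scope ring_scope.

(** The residual and Maxwellian terms of both operators depend on [f0] alone, so
    they cancel in a difference of two values: nodewise, the operators differ by
    exactly what the coefficients of their arguments differ by.  Hence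
    coercivity holds with constant 1, and both inequalities are equalities.

    What has to be established is that the coefficients do represent the
    functions.  For the first operator this is immediate, since its arguments
    [applyP Oh d P f] are defined as Bernstein expansions ([coef_expandP]).  For
    the second one, every element of V_h must have a Bernstein expansion
    ([Vh_bernstein_span]).  On an element T, the equality of the sum of the
    barycentric coordinates with 1 turns a polynomial of degree at most d into
    a homogeneous form of degree d in these coordinates ([meval_bary_form]).
    The coefficients found on two elements that share a nonempty face are equal
    for multi-indices supported on this face, because a form that vanishes on a
    face has zero coefficients there ([form_eq0_coef_eq0]).  Two elements
    without common vertex share a multi-index only if d = 0; then the functions
    of V_h are constant by connectedness of the domain ([Vh0_constant]).  So the
    local coefficients glue ([local_coef_agree]).

    Finally [normh] depends only on the values of a function on the closed
    domain ([eq_normh]), so the two sides of each inequality are compared as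
    functions there. *)

(** * Vanishing polynomials *)

Lemma poly_eq0_of_injective_roots (R : idomainType) (p : {poly R})
    (u : nat -> R) : injective u -> (forall i, root p (u i)) -> p = 0.
Proof.
move=> u_inj pu0.
apply: (@roots_geq_poly_eq0 _ p [seq u i | i <- iota 0 (size p)]).
- by apply/allP => _ /mapP[i _ ->].
- by rewrite map_inj_uniq ?iota_uniq.
- by rewrite size_map size_iota.
Qed.

Lemma digits_inj (B n : nat) (a b : 'I_n -> nat) :
    (forall i, a i < B)%N -> (forall i, b i < B)%N ->
    (\sum_i a i * B ^ i = \sum_i b i * B ^ i)%N -> a =1 b.
Proof.
elim: n a b => [|n IHn] a b ltaB ltbB; first by move=> _ [].
have lowE (c : 'I_n.+1 -> nat) :
    (\sum_i c i * B ^ i =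
     (\sum_(i < n) c (lift ord0 i) * B ^ i) * B + c ord0)%N.
  rewrite big_ord_recl expn0 muln1 addnC big_distrl /=; congr (_ + _)%N.
  by apply: eq_bigr => i _; rewrite -mulnA -expnSr.
rewrite !lowE => eq_ab.
have eq0 : a ord0 = b ord0.
  by have /(congr1 (modn^~ B)) := eq_ab; rewrite !modnMDl !modn_small.
have /IHn eqS : (\sum_(i < n) a (lift ord0 i) * B ^ i =
                 \sum_(i < n) b (lift ord0 i) * B ^ i)%N.
  move/eqP: eq_ab; rewrite eq0 eqn_add2r eqn_pmul2r => [/eqP //|].
  exact: leq_ltn_trans (ltaB ord0).
by move=> i; case: (unliftP ord0 i) => [j|] -> //; apply: eqS.
Qed.

(** * Homogeneous forms in barycentric coordinates *)

Section HomogeneousForms.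

Variables (R : realType) (n d : nat).
Local Notation multi_index := {ffun 'I_n -> 'I_d.+1}.
Implicit Types (l : {ffun 'I_n -> R}) (a : multi_index).

Definition monom l a : R := \prod_v l v ^+ a v.

Definition form (c : multi_index -> R) l : R :=
  \sum_(a : multi_index | (\sum_v a v == d)%N) c a * monom l a.

Lemma monom_eq0 (F : {set 'I_n}) l a :
  (forall v, v \notin F -> l v = 0) -> ~~ (msupport a \subset F) ->
  monom l a = 0.
Proof.
move=> l0 /fintype.subsetPn[v]; rewrite inE => a_gt0 /l0 lv0.
by rewrite /monom (bigD1 v) //= lv0 expr0n gtn_eqF // mul0r.
Qed.

(** A form that vanishes on the standard simplex with vertex set [F] vanishes on
    the whole positive cone over it, by homogeneity.  The Kronecker substitution
    of x ^ ((d+1) ^ v) for the variable of index v maps distinct monomials of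
    degree d to distinct powers of x, which leaves a univariate polynomial with
    infinitely many roots. *)
Lemma form_eq0_coef_eq0 (F : {set 'I_n}) (c : multi_index -> R) :
    F != finset.set0 ->
    (forall l, (forall v, 0 <= l v) -> \sum_v l v = 1 ->
       (forall v, v \notin F -> l v = 0) -> form c l = 0) ->
  forall a, (\sum_v a v = d)%N -> msupport a \subset F -> c a = 0.
Proof.
move=> /set0Pn[v0 Fv0] c0 a ad aF.
pose N (b : multi_index) := (\sum_v b v * d.+1 ^ v)%N.
pose good (b : multi_index) :=
  (\sum_v b v == d)%N && (msupport b \subset F).
pose p : {poly R} := \sum_(b | good b) c b *: 'X^(N b).
have N_inj : injective N.
  move=> b b' eqN; apply/ffunP => v; apply: val_inj => /=.
  exact: (@digits_inj d.+1 n (fun v => b v) (fun v => b' v)).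
have p_root (x : R) : 0 < x -> root p x.
  (* the substituted point [w] is divided by [s] to land on the simplex *)
  move=> x0; pose w v : R := if v \in F then x ^+ (d.+1 ^ v) else 0.
  have w0 v : 0 <= w v by rewrite /w; case: ifP => // _; exact/exprn_ge0/ltW.
  pose s := \sum_v w v.
  have s_gt0 : 0 < s.
    rewrite /s (bigD1 v0) //= ltr_pwDl //; first by rewrite /w Fv0 exprn_gt0.
    by rewrite sumr_ge0.
  pose l := [ffun v => w v / s].
  have lF v : v \notin F -> l v = 0.
    by move=> /negbTE vF; rewrite ffunE /w vF mul0r.
  have l_ge0 v : 0 <= l v by rewrite ffunE divr_ge0 // ltW.
  have l_sum : \sum_v l v = 1.
    by under eq_bigr do rewrite ffunE; rewrite -mulr_suml divff ?gt_eqF.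
  have /eqP := c0 l l_ge0 l_sum lF.
  have -> : form c l = p.[x] / s ^+ d.
    rewrite /form /p horner_sum mulr_suml [RHS]big_mkcondr /=.
    apply: eq_bigr => b /eqP bd; case: ifP => bF; last first.
      by rewrite (monom_eq0 lF) ?bF // mulr0.
    rewrite hornerZ hornerXn -mulrA; congr (_ * _).
    under [monom _ _]eq_bigr do rewrite ffunE expr_div_n.
    rewrite prodf_div; congr (_ / _); last by rewrite -expr_sum bd.
    rewrite /N expr_sum; apply: eq_bigr => v _.
    have [->|bv] := posnP (b v); first by rewrite mul0n !expr0.
    have -> : w v = x ^+ (d.+1 ^ v).
      by rewrite /w (fintype.subsetP bF) ?inE.
    by rewrite -exprM mulnC.
  by rewrite mulf_eq0 invr_eq0 expf_eq0 (gt_eqF s_gt0) andbF orbF.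
have p0 : p = 0.
  apply: (@poly_eq0_of_injective_roots _ p (fun i => i.+1%:R)).
    by move=> i j /eqP; rewrite eqr_nat => /eqP [].
  by move=> i; rewrite p_root.
have : p`_(N a) = c a.
  rewrite coef_sum (bigD1 a) /=; last by rewrite /good ad eqxx.
  rewrite coefZ coefXn eqxx mulr1 big1 ?addr0 // => b /andP[_ ba].
  by rewrite coefZ coefXn (inj_eq N_inj) eq_sym (negbTE ba) mulr0.
by rewrite p0 coef0.
Qed.

(** Expanding the product of sums gives one monomial for each choice [t] of an
    index in each factor; the exponent of v is the number of factors in which v
    was chosen. *)
Lemma form_prod_linear (ws : seq ('I_n -> R)) : size ws = d ->
  exists c, forall l, \prod_(w <- ws) \sum_v w v * l v = form c l.
Proof.
move=> sz.
pose w (i : 'I_d) := nth (fun=> 0) ws i.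
pose cnt (t : {ffun 'I_d -> 'I_n}) : {ffun 'I_n -> 'I_d.+1} :=
  [ffun v => inord #|[set i | t i == v]%SET|].
have cntE t v : cnt t v = #|[set i | t i == v]%SET| :> nat.
  by rewrite ffunE inordK // ltnS (leq_trans (max_card _)) ?card_ord.
have cnt_sum t : (\sum_v cnt t v = d)%N.
  under eq_bigr do rewrite cntE -sum1_card big_mkcond /=.
  rewrite exchange_big /= -[RHS]card_ord -sum1_card; apply: eq_bigr => i _.
  rewrite (bigD1 (t i)) //= inE eqxx big1 // => v vi.
  by rewrite inE eq_sym (negbTE vi).
exists (fun a => \sum_(t | cnt t == a) \prod_i w i (t i)) => l.
rewrite (big_nth (fun=> 0)) sz big_mkord bigA_distr_bigA /=.
rewrite (partition_big cnt (fun a => \sum_v a v == d)%N) /=; last first.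
  by move=> t _; rewrite cnt_sum.
apply: eq_bigr => a _; rewrite mulr_suml; apply: eq_bigr => t /eqP <-.
rewrite big_split /=; congr (_ * _).
rewrite (partition_big t xpredT) //=; apply: eq_bigr => v _.
under eq_bigr => i /eqP -> do over.
rewrite big_const -iter_mulr_1 cntE; congr iter.
by apply: eq_card => i; rewrite !inE.
Qed.

Lemma form_sum (I : Type) (r : seq I) (c : I -> multi_index -> R)
    (k : I -> R) l :
  \sum_(i <- r) k i * form (c i) l =
  form (fun a => \sum_(i <- r) k i * c i a) l.
Proof.
rewrite /form; under eq_bigr do rewrite mulr_sumr.
rewrite exchange_big /=; apply: eq_bigr => a _; rewrite mulr_suml.
by apply: eq_bigr => i _; rewrite mulrA.
Qed.

Lemma form_sub c c' l : form c l - form c' l = form (fun a => c a - c' a) l.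
Proof.
by rewrite /form -sumrB; apply: eq_bigr => a _; rewrite mulrBl.
Qed.

(** On the affine span of the vertices, each coordinate of x is a linear form in
    barycentric coordinates, and the constant 1 is their sum.  A monomial of
    degree at most d is thus a product of exactly d linear forms, after padding
    with factors equal to 1. *)
Lemma meval_bary_form (D : nat) (p : 'I_n -> 'rV[R]_D) (q : mpoly D R) :
    (mmeasure mdeg q <= d.+1)%N ->
  exists c, forall T l x, bary_rep p T l x ->
    meval (fun j => x 0 j) q = form c l.
Proof.
move=> degq.
pose ws (m : multinom D) : seq ('I_n -> R) :=
  flatten [seq nseq (m j) (fun v => p v 0 j) | j <- index_enum 'I_D]
  ++ nseq (d - mdeg m) (fun=> 1).
have ws_form (m : multinom D) : exists c, (mdeg m <= d)%N -> forall l,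
    \prod_(w <- ws m) \sum_v w v * l v = form c l.
  have [md|] := leqP (mdeg m) d; last by exists (fun=> 0).
  have [|c cE] := @form_prod_linear (ws m); last by exists c.
  rewrite size_cat size_nseq size_flatten sumnE !big_map /=.
  under eq_bigr do rewrite size_nseq.
  by rewrite -mdegE subnKC.
have [c cE] := choice ws_form.
exists (fun a => \sum_(m <- msupp q) mcoeff m q * c m a) => T l x [_ l1 _ xE].
rewrite mevalE -form_sum !big_seq; apply: eq_bigr => m mq; congr (_ * _).
rewrite -cE; last by rewrite -ltnS (leq_trans (msize_mdeg_lt mq)).
rewrite big_cat /= big_nseq.
have {}l1 : \sum_v 1 * l v = 1 by under eq_bigr do rewrite mul1r.
rewrite l1 iter_mulr_1 expr1n mulr1 big_flatten big_map /=.
apply: eq_bigr => j _; rewrite big_nseq iter_mulr_1; congr (_ ^+ _).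
rewrite xE summxE; by apply: eq_bigr => v _; rewrite mxE mulrC.
Qed.

End HomogeneousForms.

(** * Barycentric coordinates on a triangulation *)

Section Triangulation.

Variables (R : realType) (D : nat) (Oh : triangulation R D).
Local Notation p := (vertex Oh).
Local Notation n := (nvert Oh).
Implicit Types (T : {set 'I_n}) (l : {ffun 'I_n -> R}) (x : 'rV[R]_D).

Lemma bary_rep_widen T T' l x :
  T \subset T' -> bary_rep p T l x -> bary_rep p T' l x.
Proof.
move=> /fintype.subsetP TT' [l0 l1 lT xE]; split=> // v vT'; apply: lT.
by apply: contra vT'; exact: TT'.
Qed.

Lemma bary_rep_unique T l l' x : T \in elements Oh ->
  bary_rep p T l x -> bary_rep p T l' x -> l = l'.
Proof.
move=> ET [_ l1 lT xE] [_ l'1 l'T xE']; apply/ffunP => v.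
apply/eqP; rewrite -subr_eq0; apply/eqP.
pose c := [ffun v => l v - l' v].
have -> : l v - l' v = c v by rewrite ffunE.
apply: (elements_nondegenerate ET).
- by move=> w wT; rewrite ffunE lT // l'T // subr0.
- by under eq_bigr do rewrite ffunE; rewrite sumrB l1 l'1 subrr.
- under eq_bigr do rewrite ffunE scalerBl.
  by rewrite sumrB -xE -xE' subrr.
Qed.

(** By conformity, the point has barycentric coordinates on the common face,
    which are its coordinates on each of the two elements. *)
Lemma bary_rep_conforming T T' l l' x :
  T \in elements Oh -> T' \in elements Oh ->
  bary_rep p T l x -> bary_rep p T' l' x -> l = l'.
Proof.
move=> ET ET' lx l'x.
have : simplex p (T :&: T') x.
  by rewrite -elements_conforming //; split; [exists l | exists l'].
move=> [k kx].
have <- : k = l.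
  by apply: (bary_rep_unique ET) lx; apply: bary_rep_widen kx; exact: subsetIl.
by apply: (bary_rep_unique ET') l'x; apply: bary_rep_widen kx; exact: subsetIr.
Qed.

Lemma baryE T l x : T \in elements Oh -> bary_rep p T l x -> bary Oh x = l.
Proof.
move=> ET lx; apply: xget_unique; first by exists T.
by move=> l' [T' ET' l'x]; apply: bary_rep_conforming l'x lx.
Qed.

Lemma simplex_closure T x :
  T \in elements Oh -> simplex p T x -> closure (Omega Oh) x.
Proof. by move=> ET Tx; rewrite elements_cover; exists T. Qed.

Lemma vertex_bary_rep T v : v \in T ->
  bary_rep p T [ffun w => (w == v)%:R] (p v).
Proof.
move=> vT; split.
- by move=> w; rewrite ffunE ler0n.
- rewrite (bigD1 v) //= ffunE eqxx big1 ?addr0 // => w /negbTE wv.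
  by rewrite ffunE wv.
- by move=> w wT; rewrite ffunE; case: eqP wT => // ->; rewrite vT.
- rewrite (bigD1 v) //= ffunE eqxx scale1r big1 ?addr0 // => w /negbTE wv.
  by rewrite ffunE wv scale0r.
Qed.

Lemma element_vertex T : T \in elements Oh -> exists v, v \in T.
Proof.
by move=> ET; apply/card_gt0P; rewrite elements_card.
Qed.

End Triangulation.

(** * Bernstein expansions of finite element functions *)

(** A connected set of reals with two points a < b contains the infinitely many
    points a + (b - a) / (i + 1). *)
Lemma connected_finite_subsingleton (R : realType) (A : set R) (a b : R) :
  connected A -> finite_set A -> A a -> A b -> a = b.
Proof.
move=> /connected_intervalP itvA finA Aa Ab.
wlog ab : a b Aa Ab / a < b.
  by move=> H; case: (ltgtP a b) => // ab; [|symmetry]; exact: H ab.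
exfalso; pose u (i : nat) := a + (b - a) / i.+1%:R.
have u_inj : injective u.
  have ba0 : b - a != 0 by rewrite subr_eq0 gt_eqF.
  move=> i j /addrI /(mulfI ba0) /invr_inj /eqP.
  by rewrite eqr_nat => /eqP [].
have Au i : A (u i).
  apply: (itvA a b) => //; apply/andP; split.
    by rewrite lerDl divr_ge0 // subr_ge0 ltW.
  rewrite -lerBrDl ler_pdivrMr // ler_peMr ?ler1n // subr_ge0; exact: ltW.
apply: infinite_nat.
have <- : u @^-1` A = setT by apply/seteqP; split=> [] // i _; exact: Au.
by apply: finite_preimage => // i j _ _; exact: u_inj.
Qed.

Section BernsteinBasis.

Variables (R : realType) (D : nat) (Oh : triangulation R D).
Local Notation p := (vertex Oh).
Local Notation n := (nvert Oh).

(** A function of V_h with d = 0 takes at most one value on each element, so it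
    has finitely many values on a connected set. *)
Lemma Vh0_constant f x y : Vh Oh 0 f ->
  closure (Omega Oh) x -> closure (Omega Oh) y -> f x = f y.
Proof.
move=> [f_cont f_poly] Ox Oy.
have /choice[k kE] : forall T, exists k, T \in elements Oh ->
    forall z, simplex p T z -> f z = k.
  move=> T; have [ET|_] := boolP (T \in elements Oh); last by exists 0.
  have [q /msize1_polyC -> fE] := f_poly _ ET.
  by exists (mcoeff mnm0 q) => _ z /fE ->; rewrite mevalC.
apply: (@connected_finite_subsingleton _ (f @` closure (Omega Oh)));
  last 2 first.
- by exists x.
- by exists y.
- apply: connected_continuous_connected f_cont.
  exact/connected_closure/Omega_connected.
- apply: (@sub_finite_set _ _ (range k)); last exact/finite_image/finite_finset.
  move=> _ [z + <-]; rewrite elements_cover => -[T ET Tz].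
  by exists T => //; rewrite (kE T ET z Tz).
Qed.

Lemma monom_degree0 (l : {ffun 'I_n -> R}) (a : {ffun 'I_n -> 'I_1}) :
  monom l a = 1.
Proof. by rewrite /monom big1 // => v _; rewrite ord1 expr0. Qed.

Lemma local_coef_agree d f (c : {set 'I_n} -> {ffun 'I_n -> 'I_d.+1} -> R) :
    Vh Oh d f ->
    (forall T, T \in elements Oh -> forall l x, bary_rep p T l x ->
       f x = form (c T) l) ->
  forall T T' (a : {ffun 'I_n -> 'I_d.+1}),
    T \in elements Oh -> T' \in elements Oh -> (\sum_v a v = d)%N ->
    msupport a \subset T -> msupport a \subset T' -> c T a = c T' a.
Proof.
move=> fV cE T T' a ET ET' ad aT aT'; apply/eqP; rewrite -subr_eq0; apply/eqP.
have aF : msupport a \subset T :&: T' by rewrite finset.subsetI aT.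
pose c' b := c T b - c T' b.
(* On a nonempty common face, both forms compute [f]. *)
have [F0|Fn0] := eqVneq (T :&: T') finset.set0; last first.
  apply: (form_eq0_coef_eq0 (c := c') Fn0) ad aF => l l0 l1 lF.
  have lx : bary_rep p (T :&: T') l (\sum_v l v *: p v) by [].
  rewrite /c' -form_sub -(cE T ET l _ (bary_rep_widen (subsetIl _ _) lx)).
  by rewrite -(cE T' ET' l _ (bary_rep_widen (subsetIr _ _) lx)) subrr.
(* Without common vertex, the support of [a] is empty, whence [d = 0]. *)
have d0 : d = 0%N.
  rewrite -ad big1 // => v _; apply/eqP; rewrite -leqn0 leqNgt.
  apply/negP => av; have := fintype.subsetP aF v.
  by rewrite F0 !inE => /(_ av).
subst d; clear aF F0.
have [v vT] := element_vertex ET; have [v' v'T'] := element_vertex ET'.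
apply: (form_eq0_coef_eq0 (c := c') (F := T)) ad aT => [|l l0 l1 lT].
  by apply/set0Pn; exists v.
(* For [d = 0], forms are constant, so the form of [T'] can be evaluated at a
   vertex of [T']. *)
have lx : bary_rep p T l (\sum_v l v *: p v) by [].
have v'x := vertex_bary_rep v'T'.
have form_cst b (k k' : {ffun 'I_n -> R}) : form (d := 0) b k = form b k'.
  by apply: eq_bigr => a' _; rewrite !monom_degree0.
rewrite /c' -form_sub -(cE T ET l _ lx).
rewrite (form_cst (c T') l [ffun w => (w == v')%:R]) -(cE T' ET' _ _ v'x).
apply/eqP; rewrite subr_eq0; apply/eqP; apply: Vh0_constant => //.
- by apply: (simplex_closure ET); exists l.
- by apply: (simplex_closure ET'); exists [ffun w => (w == v')%:R].
Qed.

Lemma sum_dof d (F : {ffun 'I_n -> 'I_d.+1} -> R) :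
  \sum_(sigma : dof Oh d) F sigma = \sum_(a | is_dof a) F a.
Proof.
rewrite (reindex_omap (fun sigma : dof Oh d => dof_index sigma) insub) /=.
  by apply: eq_bigl => s; rewrite (valP s) valK eqxx.
by move=> a a_dof; rewrite insubT.
Qed.

(** The coefficient of a degree of freedom is read off on any element that
    contains its support; the multinomial factor is divided out because
    Bernstein functions carry it and monomials do not. *)
Lemma Vh_bernstein_span d f : Vh Oh d f ->
  exists c : dof Oh d -> R, forall x, closure (Omega Oh) x ->
    f x = \sum_sigma bernstein sigma x * c sigma.
Proof.
move=> fV.
have /choice[c cE] : forall T, exists c, T \in elements Oh ->
    forall l x, bary_rep p T l x -> f x = form (d := d) c l.
  move=> T; have [ET|_] := boolP (T \in elements Oh); last by exists (fun=> 0).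
  have [q degq fE] := fV.2 _ ET; have [c cE] := meval_bary_form p degq.
  by exists c => _ l x lx; rewrite -(cE T l x lx) fE //; exists l.
pose mult (a : {ffun 'I_n -> 'I_d.+1}) : R :=
  d`!%:R / (\prod_v (a v)`!)%N%:R.
have mult_neq0 a : mult a != 0.
  rewrite mulf_neq0 ?invr_eq0 ?pnatr_eq0 -?lt0n ?fact_gt0 //.
  by rewrite prodn_gt0 // => v; rewrite fact_gt0.
pose el (a : {ffun 'I_n -> 'I_d.+1}) :=
  odflt finset.set0 [pick T in elements Oh | msupport a \subset T].
exists (fun sigma => c (el sigma) sigma / mult sigma) => x.
rewrite elements_cover => -[T ET [l lx]].
rewrite (cE T ET l x lx); have [_ _ lT _] := lx.
rewrite (sum_dof
  (fun a => mult a * (\prod_v bary Oh x v ^+ a v) * (c (el a) a / mult a))).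
rewrite /form big_mkcond [RHS]big_mkcond /=; apply: eq_bigr => a _.
rewrite (baryE ET lx) -/(monom l a) /is_dof.
have [ad|//] := eqVneq (\sum_v a v)%N d; rewrite /=.
have [aT|aT] := boolP (msupport a \subset T); last first.
  by rewrite (monom_eq0 lT aT) !(mulr0, mul0r) if_same.
have -> : [exists T in elements Oh, msupport a \subset T].
  by apply/existsP; exists T; rewrite ET.
rewrite /el; case: pickP => [T' /andP[ET' aT']|/(_ T)]; last by rewrite ET aT.
by rewrite (local_coef_agree fV cE ET ET') //= [RHS]mulrC mulrA mulfVK.
Qed.

Lemma coefP d m (f : 'rV[R]_D -> 'cV[R]_m) x :
  VhV Oh d f -> closure (Omega Oh) x -> f x = Defs.expand (coef Oh d f) x.
Proof.
move=> fV Ox; suff : exists c : {ffun dof Oh d -> 'cV[R]_m},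
    forall y, closure (Omega Oh) y -> f y = Defs.expand c y.
  by move=> /(xgetPex [ffun=> 0]) /(_ x Ox).
have /choice[c cE] := fun i => Vh_bernstein_span (fV i).
exists [ffun sigma => \col_i c i sigma] => y Oy.
apply/colP => i; rewrite cE // summxE; apply: eq_bigr => sigma _.
by rewrite ffunE !mxE.
Qed.

(** The coefficients chosen for an expansion represent the same function. *)
Lemma coef_expandP d m (c : {ffun dof Oh d -> 'cV[R]_m}) x :
  closure (Omega Oh) x ->
  Defs.expand c x = Defs.expand (coef Oh d (Defs.expand c)) x.
Proof.
move=> Ox; suff : exists c' : {ffun dof Oh d -> 'cV[R]_m},
    forall y, closure (Omega Oh) y -> Defs.expand c y = Defs.expand c' y.
  by move=> /(xgetPex [ffun=> 0]) /(_ x Ox).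
by exists c.
Qed.

(** The coefficients are chosen from a set that depends only on the values of
    the function on the closed domain. *)
Lemma eq_normh d m (w w' : 'rV[R]_D -> 'cV[R]_m) :
  (forall x, closure (Omega Oh) x -> w x = w' x) ->
  normh Oh d w = normh Oh d w'.
Proof.
move=> ww'; rewrite /normh /coef.
suff -> : [set c : {ffun dof Oh d -> 'cV[R]_m} |
            forall x, closure (Omega Oh) x -> w x = Defs.expand c x] =
          [set c | forall x, closure (Omega Oh) x -> w' x = Defs.expand c x].
  by [].
by apply/seteqP; split => c wE x Ox; have := wE x Ox; rewrite ww'.
Qed.

Lemma expand_sub d m (a b : {ffun dof Oh d -> 'cV[R]_m}) x :
  Defs.expand a x - Defs.expand b x = Defs.expand [ffun s => a s - b s] x.
Proof.
by rewrite /expand -sumrB; apply: eq_bigr => s _; rewrite ffunE scalerBr.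
Qed.

End BernsteinBasis.

(** * Coercivity *)

Theorem propositionB2 (R : realType) (D : nat) (Oh : triangulation R D)
    (d K L M : nat) (hKL : (K < L)%N) (hM : (1 <= M)%N)
    (P : 'M[R]_(K, L))
    (Mx : 'cV[R]_K -> 'cV[R]_L) (hMx : lipschitz_map Mx)
    (U : set 'cV[R]_K) (hPM : forall u, U u -> P *m Mx u = u)
    (phi : residuals Oh d L)
    (eps : R) (heps : 0 < eps)
    (dt : 'I_M -> R) (hdt : forall m, 0 < dt m)
    (f0 : 'rV[R]_D -> 'cV[R]_L) (hf0 : VhV Oh d f0)
    (um : 'I_M -> 'rV[R]_D -> 'cV[R]_K)
    (hum : forall m, is_aux_solution P phi (dt m) f0 (um m)) :
  exists2 alpha1 : R, 0 < alpha1 &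
    forall (f g : 'rV[R]_D -> 'cV[R]_L) (m : 'I_M),
      VhV Oh d f -> VhV Oh d g ->
      (normh Oh d (L1u P phi (dt m) f0 (applyP Oh d P f)
                   \- L1u P phi (dt m) f0 (applyP Oh d P g))
       >= alpha1 * normh Oh d (applyP Oh d P f \- applyP Oh d P g))
      /\
      (normh Oh d (L1 Mx phi eps (dt m) (um m) f0 f
                   \- L1 Mx phi eps (dt m) (um m) f0 g)
       >= alpha1 * normh Oh d (f \- g)).
Proof.
have subKA k (x y z : 'cV[R]_k) : x + z - (y + z) = x - y.
  by rewrite (addrC y) addrKA.
exists 1 => // f g m fV gV; rewrite !mul1r; split.
- rewrite (eq_normh _ (w' := applyP Oh d P f \- applyP Oh d P g)) // => x Ox.
  have PE h : applyP Oh d P h x =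
      Defs.expand (coef Oh d (applyP Oh d P h)) x by exact: coef_expandP.
  rewrite /L1u /= !PE !expand_sub; congr Defs.expand; apply/ffunP => s.
  by rewrite !ffunE /L1u_node !subKA.
- rewrite (eq_normh _ (w' := f \- g)) // => x Ox.
  rewrite /L1 /= expand_sub (coefP fV Ox) (coefP gV Ox) expand_sub.
  congr Defs.expand; apply/ffunP => s; rewrite !ffunE /L1_node.
  by rewrite !subKA.
Qed.
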